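(* Let $a_1,\dots,a_4,b_1,\dots,b_4$ be generic nonzero complex parameters, $q=a_3a_4b_1b_2/(a_1a_2b_3b_4)$, let $z$ be generic, and regard $y(z),y(qz),y(z/q),T^{-1}(y(z))$ as generic nonzero parameters. (1) The equation $$\frac{(a_1-z)(a_2-z)}{a_1a_2(z-f)}y(qz)-\left(c_0+c_1z+\frac{c_2z}{z-f}+\frac{c_3z}{z-qf}\right)y(z)+\frac{a_1a_2(z-qa_3)(z-qa_4)}{b_3b_4q^2(z-qf)}y\!\left(\tfrac zq\right)=0,$$ where $c_0=-\frac{a_1a_2}{f}\big(\frac1{b_1}+\frac1{b_2}\big)$, $c_1=\frac1q\big(\frac1{b_3}+\frac1{b_4}\big)$, $c_2=\frac{(f-a_1)(f-a_2)}{qfg}$, $c_3=\frac{(f-a_3)(f-a_4)g}{b_3b_4f}$, viewed (after clearing denominators) as the equation of an algebraic curve in $(f,g)\in\mathbb P^1\times\mathbb P^1$, is uniquely characterized as a curve of bi-degree $(3,2)$ passing through the $12$ points $$(0,b_1/q),\ (0,b_2/q),\ (\infty,b_3),\ (\infty,b_4),\ (a_1,0),\ (a_2,0),\ (a_3,\infty),\ (a_4,\infty),$$ $$(z,\infty),\quad \left(\tfrac zq,0\right),\quad \left(z,\tfrac{a_1a_2}{q}\tfrac{y(z)}{y(qz)}\right),\quad \left(\tfrac zq,\tfrac{a_1a_2}{q}\tfrac{y(z/q)}{y(z)}\right).$$ (2) Similarly, the equation $$q\,g\,y(qz)-a_1a_2\,y(z)+z(z-f)\,T^{-1}(y(z))=0$$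 is characterized as a curve of bi-degree $(1,1)$ in $(f,g)\in\mathbb P^1\times\mathbb P^1$ passing through the $3$ points $$(\infty,\infty),\quad \left(z,\tfrac{a_1a_2}{q}\tfrac{y(z)}{y(qz)}\right),\quad \left(z-\tfrac{a_1a_2}{z}\tfrac{y(z)}{T^{-1}y(z)},\,0\right).$$
   Context: $(f,g)$ are inhomogeneous coordinates on $\mathbb P^1\times\mathbb P^1$ over $\mathbb C$; a curve of bi-degree $(m,n)$ is the zero locus of a nonzero polynomial of degree at most $m$ in $f$ and at most $n$ in $g$ (bihomogenized, so that points with coordinate $\infty$ make sense). The two equations are a scalar Lax pair of the $q$-difference Painlevé VI equation, whose time evolution is denoted $T$; for this statement $T^{-1}(y(z))$ is just one more free parameter. *)

(* Defs.v *)
From mathcomp Require Import all_boot all_order all_algebra.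
From mathcomp Require Import reals complex mpoly.

Set Implicit Arguments.
Unset Strict Implicit.
Unset Printing Implicit Defensive.

Import GRing.Theory.
Local Open Scope ring_scope.

(* The projective line as C + {oo}, with homogeneous coordinates
   [x : 1] for finite x and [1 : 0] for oo. *)
Definition P1 (C : Type) := option C.
Definition fin (C : Type) (x : C) : P1 C := Some x.
Definition oo {C : Type} : P1 C := None.
Definition hnum (C : fieldType) (x : P1 C) : C := if x is Some x' then x' else 1.
Definition hden (C : fieldType) (x : P1 C) : C := if x is Some _ then 1 else 0.

(* Polynomials in (f, g) are elements P of {poly {poly C}}: f is the outer
   variable and g the inner one, so that P.[f, g] is the value at (f, g) and
   P`_i`_j is the coefficient of f^i g^j. *)
Definition bideg_le (C : fieldType) (m n : nat) (P : {poly {poly C}}) : bool :=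
  (size P <= m.+1)%N && (sizeY P <= n.+1)%N.

(* Value of the bihomogenization of P of bi-degree (m, n). *)
Definition bihom_eval (C : fieldType) (m n : nat) (P : {poly {poly C}})
    (p : P1 C * P1 C) : C :=
  \sum_(i < m.+1) \sum_(j < n.+1)
    P`_i`_j * hnum p.1 ^+ i * hden p.1 ^+ (m - i)
            * hnum p.2 ^+ j * hden p.2 ^+ (n - j).

Definition on_curve (C : fieldType) (m n : nat) (P : {poly {poly C}})
    (p : P1 C * P1 C) : bool :=
  bihom_eval m n P p == 0.

Definition curve_through (C : fieldType) (m n : nat)
    (pts : seq (P1 C * P1 C)) (P : {poly {poly C}}) : Prop :=
  [/\ P != 0, bideg_le m n P & all (on_curve m n P) pts].

(* Uniqueness holds both for the defining polynomial up to a nonzero scalar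
   (the curve with multiplicities) and for the zero locus. *)
Definition unique_curve_through (C : fieldType) (m n : nat)
    (pts : seq (P1 C * P1 C)) (E : {poly {poly C}}) : Prop :=
  curve_through m n pts E /\
  forall P : {poly {poly C}}, curve_through m n pts P ->
    (exists2 c : C, c != 0 & P = c%:P *: E)
    /\ on_curve m n P =1 on_curve m n E.

(* E is the polynomial obtained from L(f, g) = 0 on multiplying by the common
   denominator den(f, g); as C is infinite in the applications, this determines
   E whenever den is a nonzero polynomial function. *)
Definition cleared (C : fieldType) (den L : C -> C -> C)
    (E : {poly {poly C}}) : Prop :=
  forall f g : C, den f g != 0 -> E.[f, g] = den f g * L f g.

(* In what follows y, yq, yp, yT stand for y(z), y(qz), y(z/q), T^{-1}(y(z)). *)

Definition lax1 (C : fieldType) (a1 a2 a3 a4 b1 b2 b3 b4 q z y yq yp : C)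
    (f g : C) : C :=
  let c0 := - (a1 * a2 / f) * (b1^-1 + b2^-1) in
  let c1 := q^-1 * (b3^-1 + b4^-1) in
  let c2 := (f - a1) * (f - a2) / (q * f * g) in
  let c3 := (f - a3) * (f - a4) * g / (b3 * b4 * f) in
  (a1 - z) * (a2 - z) / (a1 * a2 * (z - f)) * yq
  - (c0 + c1 * z + c2 * z / (z - f) + c3 * z / (z - q * f)) * y
  + a1 * a2 * (z - q * a3) * (z - q * a4)
      / (b3 * b4 * q ^+ 2 * (z - q * f)) * yp.

Definition lax1_den (C : fieldType) (q z : C) (f g : C) : C :=
  f * g * (z - f) * (z - q * f).

Definition lax1_points (C : fieldType)
    (a1 a2 a3 a4 b1 b2 b3 b4 q z y yq yp : C) : seq (P1 C * P1 C) :=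
  [:: (fin 0, fin (b1 / q)); (fin 0, fin (b2 / q)); (oo, fin b3); (oo, fin b4);
      (fin a1, fin 0); (fin a2, fin 0); (fin a3, oo); (fin a4, oo);
      (fin z, oo); (fin (z / q), fin 0);
      (fin z, fin (a1 * a2 / q * (y / yq)));
      (fin (z / q), fin (a1 * a2 / q * (yp / y)))].

Definition lax2 (C : fieldType) (a1 a2 q z y yq yT : C) (f g : C) : C :=
  q * g * yq - a1 * a2 * y + z * (z - f) * yT.

Definition lax2_points (C : fieldType) (a1 a2 q z y yq yT : C) :
    seq (P1 C * P1 C) :=
  [:: (oo, oo);
      (fin z, fin (a1 * a2 / q * (y / yq)));
      (fin (z - a1 * a2 / z * (y / yT)), fin 0)].

(* Main.v *)
(** In both parts the incidence conditions are linear in the coefficients of a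
    curve, so it suffices that the displayed curve passes through the points
    and that a curve through them with one particular coefficient equal to zero
    (that of f^3 g^2, resp. f) vanishes.  For bi-degree (3,2), if the f^3 g^2
    coefficient is zero, then the points on f = oo kill the coefficients of f^3,
    those on g = oo kill the coefficients of g^2, those on f = 0 kill the terms
    without f, and those on g = 0 kill the terms without g.  Only f g and
    f^2 g remain, and they are killed by the last two points, which have nonzero
    g-coordinate and distinct nonzero f-coordinates z and z/q. *)

Require Import Defs.
From mathcomp Require Import all_boot all_order all_algebra.
From mathcomp Require Import reals complex mpoly.
From mathcomp Require Import ring.

Set Implicit Arguments.
Unset Strict Implicit.
Unset Printing Implicit Defensive.

Import GRing.Theory.
Local Open Scope ring_scope.

(** * Polynomials of bounded bi-degree and linearity of incidence *)

Definition bipoly (C : fieldType) (m n : nat) (e : nat -> nat -> C) :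
    {poly {poly C}} :=
  \poly_(i < m.+1) \poly_(j < n.+1) e i j.

Lemma coef_bipoly (C : fieldType) (m n : nat) (e : nat -> nat -> C) (i j : nat) :
  (bipoly m n e)`_i`_j = if (i <= m)%N && (j <= n)%N then e i j else 0.
Proof.
rewrite /bipoly coef_poly ltnS; case: leqP => _ /=; last by rewrite coef0.
by rewrite coef_poly ltnS.
Qed.

Lemma bideg_leP (C : fieldType) (m n : nat) (P : {poly {poly C}}) :
  reflect (forall i j, ~~ ((i <= m)%N && (j <= n)%N) -> P`_i`_j = 0)
          (bideg_le m n P).
Proof.
apply: (iffP andP) => [[sP sYP] i j | P0].
  rewrite negb_and -!ltnNge => /orP[lt_mi | lt_nj].
    by rewrite [P`_i]nth_default ?coef0 // (leq_trans sP).
  by rewrite nth_default // (leq_trans (max_size_coefXY _ _)) // (leq_trans sYP).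
split; first by apply/leq_sizeP => i lt_mi; apply/polyP => j;
  rewrite coef0 P0 // negb_and -!ltnNge lt_mi.
apply/bigmax_leqP => i _; apply/leq_sizeP => j lt_nj.
by rewrite P0 // negb_and -!ltnNge lt_nj orbT.
Qed.

Lemma bideg_bipoly (C : fieldType) (m n : nat) (e : nat -> nat -> C) :
  bideg_le m n (bipoly m n e).
Proof. by apply/bideg_leP => i j /negPf out; rewrite coef_bipoly out. Qed.

Lemma horner2_bipoly (C : fieldType) (m n : nat) (e : nat -> nat -> C)
    (f g : C) :
  (bipoly m n e).[f, g] =
  \sum_(i < m.+1) \sum_(j < n.+1) e i j * g ^+ j * f ^+ i.
Proof.
rewrite horner_poly horner_sum; apply: eq_bigr => i _.
by rewrite -rmorphXn hornerM hornerC horner_poly mulr_suml.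
Qed.

Lemma bihom_evalB (C : fieldType) (m n : nat) (c : C) (P Q : {poly {poly C}})
    (p : P1 C * P1 C) :
  bihom_eval m n (P - c%:P *: Q) p
  = bihom_eval m n P p - c * bihom_eval m n Q p.
Proof.
rewrite /bihom_eval mulr_sumr -sumrB; apply: eq_bigr => i _.
rewrite mulr_sumr -sumrB; apply: eq_bigr => j _.
by rewrite coefB coefB coefZ coefCM; ring.
Qed.

(** If [c] is the ratio of the coefficients of [P] and [E] at f^k g^l, then [P - c%:P *: E] still
    vanishes at the points and its coefficient there is 0, so it is 0. *)
Lemma unique_curve_through_coef (C : fieldType) (m n : nat)
    (pts : seq (P1 C * P1 C)) (E : {poly {poly C}}) (k l : nat) :
  bideg_le m n E -> all (on_curve m n E) pts -> E`_k`_l != 0 ->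
  (forall P : {poly {poly C}}, bideg_le m n P -> all (on_curve m n P) pts ->
     P`_k`_l = 0 -> P = 0) ->
  unique_curve_through m n pts E.
Proof.
move=> dE onE Ekl inj; split.
  by split=> //; apply: contra_neq Ekl => ->; rewrite !coef0.
move=> P [P0 dP onP]; pose c := P`_k`_l / E`_k`_l.
have PE : P = c%:P *: E.
  apply/eqP; rewrite -subr_eq0; apply/eqP; apply: inj.
  - apply/bideg_leP => i j out; rewrite coefB coefB coefZ coefCM.
    rewrite (elimT (bideg_leP _ _ _) dE) // (elimT (bideg_leP _ _ _) dP) //.
    by rewrite mulr0 subr0.
  - apply/allP => p pin; rewrite /on_curve bihom_evalB.
    have /eqP -> := allP onE p pin; have /eqP -> := allP onP p pin.
    by rewrite mulr0 subr0.
  - by rewrite coefB coefB coefZ coefCM /c divfK // subrr.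
have c0 : c != 0 by apply: contra_neq P0 => c0; rewrite PE c0 scale0r.
split; first by exists c.
move=> p; rewrite /on_curve.
have -> : bihom_eval m n P p = c * bihom_eval m n E p.
  apply/eqP; rewrite -subr_eq0 -bihom_evalB PE subrr; apply/eqP.
  by rewrite /bihom_eval; apply: big1 => i _; apply: big1 => j _;
    rewrite !coef0 !mul0r.
by rewrite mulf_eq0 (negPf c0).
Qed.

(** * Vanishing from too many roots, and evaluation in the two bi-degrees *)

Lemma affine_eq0 (C : fieldType) (u v x x' : C) :
  x != x' -> u + v * x = 0 -> u + v * x' = 0 -> u = 0 /\ v = 0.
Proof.
move=> xx' e e'; have v0 : v = 0.
  apply/eqP; have : v * (x - x') = 0.
    by rewrite -[RHS](subrr 0) -{1}e -e'; ring.
  by move/eqP; rewrite mulf_eq0 subr_eq0 (negPf xx') orbF.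
by split=> //; rewrite v0 mul0r addr0 in e.
Qed.

Lemma quadratic_eq0 (C : fieldType) (u v w x x' x'' : C) :
  x != x' -> x != x'' -> x' != x'' ->
  u + v * x + w * x ^+ 2 = 0 -> u + v * x' + w * x' ^+ 2 = 0 ->
  u + v * x'' + w * x'' ^+ 2 = 0 -> [/\ u = 0, v = 0 & w = 0].
Proof.
move=> xx' xx'' x'x'' e e' e''.
(* Divided difference of the quadratic between [x] and [t]. It is affine in [t] and vanishes at both
   [x'] and [x'']. *)
have slope t : x != t -> u + v * t + w * t ^+ 2 = 0 -> (v + w * x) + w * t = 0.
  move=> xt et; apply/eqP; have : (v + w * x + w * t) * (x - t) = 0.
    by rewrite -[RHS](subrr 0) -{1}e -et; ring.
  by move/eqP; rewrite mulf_eq0 subr_eq0 (negPf xt) orbF.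
have [vw w0] := affine_eq0 x'x'' (slope _ xx' e') (slope _ xx'' e'').
have v0 : v = 0 by rewrite w0 mul0r addr0 in vw.
by split=> //; rewrite v0 w0 !mul0r !addr0 in e.
Qed.

(** A quadratic in g, homogenized at [v : v']; at g = oo, where v' = 0, only the coefficient of g^2
    survives. *)
Definition hform2 (C : fieldType) (p : {poly C}) (v v' : C) : C :=
  p`_0 * v' ^+ 2 + p`_1 * v * v' + p`_2 * v ^+ 2.

Lemma bihom_eval32 (C : fieldType) (P : {poly {poly C}}) (p : P1 C * P1 C) :
  let u := hnum p.1 in let u' := hden p.1 in
  let form i := hform2 P`_i (hnum p.2) (hden p.2) in
  bihom_eval 3 2 P p
  = form 0%N * u' ^+ 3 + form 1%N * u * u' ^+ 2 + form 2%N * u ^+ 2 * u'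
    + form 3%N * u ^+ 3.
Proof.
rewrite /bihom_eval !big_ord_recl !big_ord0 /= /bump /= /hform2.
by rewrite !subSS ?subn0 ?subnn; ring.
Qed.

Lemma bihom_eval11 (C : fieldType) (P : {poly {poly C}}) (p : P1 C * P1 C) :
  let u := hnum p.1 in let u' := hden p.1 in
  let v := hnum p.2 in let v' := hden p.2 in
  bihom_eval 1 1 P p
  = P`_0`_0 * u' * v' + P`_0`_1 * u' * v + P`_1`_0 * u * v' + P`_1`_1 * u * v.
Proof.
rewrite /bihom_eval !big_ord_recl !big_ord0 /= /bump /=.
by rewrite !subSS ?subn0 ?subnn; ring.
Qed.

(** * The first equation, in bi-degree (3,2) *)

(* Coefficient of f^i g^j in [lax1_den] times [lax1]; k0 and k2 multiply the
   expansions of (f - a1)(f - a2)(z - q f) and (f - a3)(f - a4)(z - f). *)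
Definition lax1_coef (C : fieldType)
    (a1 a2 a3 a4 b1 b2 b3 b4 q z y yq yp : C) (i j : nat) : C :=
  let A := (a1 - z) * (a2 - z) / (a1 * a2) * yq in
  let B := a1 * a2 * (z - q * a3) * (z - q * a4) / (b3 * b4 * q ^+ 2) * yp in
  let D := a1 * a2 * (b1^-1 + b2^-1) * y in
  let c1 := q^-1 * (b3^-1 + b4^-1) * y in
  let k0 := - (y * z / q) in
  let k2 := - (y * z / (b3 * b4)) in
  nth 0 (nth [::] [::
    [:: k0 * (a1 * a2 * z); D * z ^+ 2; k2 * (a3 * a4 * z)];
    [:: - k0 * ((a1 + a2) * z + q * (a1 * a2));
        A * z + B * z - D * (1 + q) * z - c1 * z ^+ 3;
        - k2 * ((a3 + a4) * z + a3 * a4)];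
    [:: k0 * (z + q * (a1 + a2));
        - (q * A) - B + D * q + c1 * (1 + q) * z ^+ 2;
        k2 * (z + (a3 + a4))];
    [:: - k0 * q; - c1 * q * z; - k2]] i) j.

Lemma cleared_lax1 (C : fieldType) (a1 a2 a3 a4 b1 b2 b3 b4 q z y yq yp : C) :
  all (fun x => x != 0) [:: a1; a2; b1; b2; b3; b4; q] ->
  cleared (lax1_den q z) (lax1 a1 a2 a3 a4 b1 b2 b3 b4 q z y yq yp)
    (bipoly 3 2 (lax1_coef a1 a2 a3 a4 b1 b2 b3 b4 q z y yq yp)).
Proof.
move=> /= /and5P[a10 a20 b10 b20 /and4P[b30 b40 q0 _]] f g.
rewrite /lax1_den !mulf_eq0 !negb_or => /andP[/andP[/andP[f0 g0] zf] zqf].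
rewrite horner2_bipoly !big_ord_recl !big_ord0 /lax1_coef /lax1 /= /bump /=.
by field; rewrite f0 g0 zf zqf a10 a20 b10 b20 b30 b40 q0.
Qed.

(** The value of [q] makes the row f^0 a multiple of (g - b1/q)(g - b2/q). The row f^3 is a multiple
    of (g - b3)(g - b4), and the columns g^0 and g^2 have the factors (f - a1)(f - a2)(z - q f) and
    (f - a3)(f - a4)(z - f). *)
Lemma all_lax1_points (C : fieldType)
    (a1 a2 a3 a4 b1 b2 b3 b4 z y yq yp : C) :
  all (fun x => x != 0) [:: a1; a2; a3; a4; b1; b2; b3; b4; y; yq] ->
  let q := a3 * a4 * b1 * b2 / (a1 * a2 * b3 * b4) in
  all (on_curve 3 2
         (bipoly 3 2 (lax1_coef a1 a2 a3 a4 b1 b2 b3 b4 q z y yq yp)))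
      (lax1_points a1 a2 a3 a4 b1 b2 b3 b4 q z y yq yp).
Proof.
move=> /= /and5P[a10 a20 a30 a40 /and5P[b10 b20 b30 b40 /and3P[y0 yq0 _]]].
rewrite /on_curve !bihom_eval32 /hform2 /= !coef_bipoly /= /lax1_coef /=.
repeat (apply/andP; split); rewrite //; apply/eqP; field;
  by rewrite ?a10 ?a20 ?a30 ?a40 ?b10 ?b20 ?b30 ?b40 ?y0 ?yq0.
Qed.

Lemma lax1_points_inj (C : fieldType)
    (a1 a2 a3 a4 b1 b2 b3 b4 q z y yq yp : C) (P : {poly {poly C}}) :
  all (fun x => x != 0) [:: a1; a2; q; y; yq; yp; z; q - 1; a1 - a2; a3 - a4;
                            a3 - z; a4 - z; b1 - b2; b3 - b4] ->
  bideg_le 3 2 P ->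
  all (on_curve 3 2 P) (lax1_points a1 a2 a3 a4 b1 b2 b3 b4 q z y yq yp) ->
  P`_3`_2 = 0 -> P = 0.
Proof.
move=> /= /and5P[a10 a20 q0 y0 /and5P[yq0 yp0 z0 q1 /and5P[]]].
rewrite !subr_eq0 => a12 a34 a3z a4z /and3P[b12 b34 _] dP.
rewrite /on_curve !bihom_eval32 /hform2 /=.
rewrite !(expr0n, expr1n, mulr0, mulr1, mul0r, addr0, add0r) /=.
move=> /and5P[/eqP h1 /eqP h2 /eqP h3 /eqP h4 /and5P[/eqP h5 /eqP h6 /eqP h7
  /eqP h8 /and5P[/eqP h9 _ /eqP h11 /eqP h12 _]]] p32.
rewrite p32 !(mul0r, addr0) in h3 h4 h7 h8 h9.
have [p30 p31] := affine_eq0 b34 h3 h4.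
have [p02 p12 p22] := quadratic_eq0 a34 a3z a4z h7 h8 h9.
rewrite p02 !(mul0r, addr0) in h1 h2.
have bq : b1 / q != b2 / q by rewrite (inj_eq (mulIf _)) ?invr_eq0.
have [p00 p01] := affine_eq0 bq h1 h2.
rewrite p30 !(mul0r, addr0) in h5 h6.
(* Since [P]_0[_0] is 0, f = 0 is a third root of the column g^0, next to [a1] and [a2]; it serves
   again for the column g^1 below. *)
have at0 v w : P`_0`_0 + v * 0 + w * 0 ^+ 2 = 0 by rewrite p00; ring.
have [_ p10 p20] := quadratic_eq0 a12 a10 a20 h5 h6 (at0 _ _).
set c := a1 * a2 / q * (y / yq) in h11; set d := a1 * a2 / q * (yp / y) in h12.
have c0 : c != 0 by rewrite !mulf_neq0 ?invr_eq0.
have d0 : d != 0 by rewrite !mulf_neq0 ?invr_eq0.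
have zq0 : z / q != 0 by rewrite mulf_neq0 ?invr_eq0.
(* Here q != 1 enters: z = z/q would give z (q - 1) = 0. *)
have zzq : z != z / q.
  apply: contra_neq q1 => zE; apply: (mulfI z0).
  by rewrite mulr0 mulrBr mulr1 {1}zE divfK ?subrr.
rewrite !(p00, p01, p02, p10, p12, p20, p22, p30, p31, p32) in h11 h12 at0.
(* The hypothesis has the shape of [h11] and [h12] after the known zeros are substituted. Cancelling
   the nonzero g-coordinate [e] leaves a quadratic in f with roots z, z/q and 0. *)
have middle_row x e : e != 0 ->
    0 + 0 * e + 0 * e ^+ 2 + (0 + P`_1`_1 * e + 0 * e ^+ 2) * x
    + (0 + P`_2`_1 * e + 0 * e ^+ 2) * x ^+ 2
    + (0 + 0 * e + 0 * e ^+ 2) * x ^+ 3 = 0 ->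
    0 + P`_1`_1 * x + P`_2`_1 * x ^+ 2 = 0.
  by move=> e0 h; apply: (mulfI e0); rewrite mulr0 -[RHS]h; ring.
have [_ p11 p21] := quadratic_eq0 zzq z0 zq0
  (middle_row _ _ c0 h11) (middle_row _ _ d0 h12) (at0 _ _).
apply/polyP => i; apply/polyP => j; rewrite !coef0.
have [/andP[] | out] := boolP ((i <= 3)%N && (j <= 2)%N); last first.
  exact: (elimT (bideg_leP _ _ _) dP).
by move: i j => [|[|[|[|?]]]] [|[|[|?]]].
Qed.

(** * The second equation, in bi-degree (1,1) *)

Definition lax2_coef (C : fieldType) (a1 a2 q z y yq yT : C) (i j : nat) : C :=
  nth 0 (nth [::] [:: [:: z ^+ 2 * yT - a1 * a2 * y; q * yq];
                      [:: - (z * yT); 0]] i) j.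

Lemma cleared_lax2 (C : fieldType) (a1 a2 q z y yq yT : C) :
  cleared (fun _ _ => 1) (lax2 a1 a2 q z y yq yT)
    (bipoly 1 1 (lax2_coef a1 a2 q z y yq yT)).
Proof.
move=> f g _.
rewrite horner2_bipoly !big_ord_recl !big_ord0 /lax2_coef /lax2 /= /bump /=.
by ring.
Qed.

Lemma unique_lax2 (C : fieldType) (a1 a2 q z y yq yT : C) :
  all (fun x => x != 0) [:: a1; a2; q; z; y; yq; yT] ->
  unique_curve_through 1 1 (lax2_points a1 a2 q z y yq yT)
    (bipoly 1 1 (lax2_coef a1 a2 q z y yq yT)).
Proof.
move=> /= /and5P[a10 a20 q0 z0 /and4P[y0 yq0 yT0 _]].
apply: (@unique_curve_through_coef _ _ _ _ _ 1 0).
- exact: bideg_bipoly.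
- rewrite /= /on_curve !bihom_eval11 !coef_bipoly /lax2_coef /=.
  repeat (apply/andP; split); rewrite //; apply/eqP; field;
    by rewrite ?q0 ?yq0 ?z0 ?yT0.
- by rewrite coef_bipoly /lax2_coef /= oppr_eq0 mulf_neq0.
move=> P dP; rewrite /= /on_curve !bihom_eval11 /=.
(* The point (oo, oo) kills the coefficient of f g. With no f term left, the point on g = 0 kills
   the constant, and the remaining point, whose g-coordinate is nonzero, kills the coefficient of
   g. *)
move=> /and4P[/eqP h1 /eqP h2 /eqP h3 _] p10.
rewrite !(mul0r, mulr0, mulr1, add0r, addr0) in h1 h2 h3.
rewrite p10 h1 !mul0r !addr0 in h2 h3.
rewrite h3 add0r in h2.
have p01 : P`_0`_1 = 0.
  by apply/eqP; move/eqP: h2; rewrite !mulf_eq0 !invr_eq0 (negPf a10) (negPf a20)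
    (negPf q0) (negPf y0) (negPf yq0) !orbF.
apply/polyP => i; apply/polyP => j; rewrite !coef0.
have [/andP[] | out] := boolP ((i <= 1)%N && (j <= 1)%N); last first.
  exact: (elimT (bideg_leP _ _ _) dP).
by move: i j => [|[|?]] [|[|?]].
Qed.

(** * An explicit genericity condition and the conclusion *)

(* "Generic" : outside the zero set of some nonzero polynomial G in the 13
   free parameters a_i, b_i, z, y(z), y(qz), y(z/q), T^{-1}(y(z)). *)
Theorem proposition1 (R : realType) :
  exists G : {mpoly (complex R)[13]}, G != 0 /\
  forall a1 a2 a3 a4 b1 b2 b3 b4 z y yq yp yT : complex R,
    all (fun x => x != 0) [:: a1; a2; a3; a4; b1; b2; b3; b4; y; yq; yp; yT] ->
    G.@[tnth [tuple a1; a2; a3; a4; b1; b2; b3; b4; z; y; yq; yp; yT]] != 0 ->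
    let q := a3 * a4 * b1 * b2 / (a1 * a2 * b3 * b4) in
    (exists E1 : {poly {poly complex R}},
       cleared (lax1_den q z) (lax1 a1 a2 a3 a4 b1 b2 b3 b4 q z y yq yp) E1 /\
       unique_curve_through 3 2
         (lax1_points a1 a2 a3 a4 b1 b2 b3 b4 q z y yq yp) E1)
    /\
    (exists E2 : {poly {poly complex R}},
       cleared (fun _ _ => 1) (lax2 a1 a2 q z y yq yT) E2 /\
       unique_curve_through 1 1 (lax2_points a1 a2 q z y yq yT) E2).
Proof.
pose X k (ltk : (k < 13)%N) : {mpoly (complex R)[13]} := 'X_(Ordinal ltk).
pose A1 := X 0%N isT; pose A2 := X 1%N isT; pose A3 := X 2%N isT.
pose A4 := X 3%N isT; pose B1 := X 4%N isT; pose B2 := X 5%N isT.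
pose B3 := X 6%N isT; pose B4 := X 7%N isT; pose Z := X 8%N isT.
(* The factors express z != 0, q != 1 with denominators cleared, and the distinctness of the points
   used on each of the lines f = 0, f = oo, g = 0 and g = oo. *)
pose G := Z * (A3 * A4 * B1 * B2 - A1 * A2 * B3 * B4) * (A1 - A2) * (A3 - A4)
  * (A3 - Z) * (A4 - Z) * (B1 - B2) * (B3 - B4).
have GE (v : 13.-tuple (complex R)) : let x k := nth 0 v k in
    G.@[tnth v] =
    x 8%N * (x 2%N * x 3%N * x 4%N * x 5%N - x 0%N * x 1%N * x 6%N * x 7%N)
      * (x 0%N - x 1%N) * (x 2%N - x 3%N) * (x 2%N - x 8%N) * (x 3%N - x 8%N)
      * (x 4%N - x 5%N) * (x 6%N - x 7%N).
  by rewrite /G !(mevalM, mevalB) !mevalXU !(tnth_nth 0).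
exists G; split.
  (* A sample point where [G] takes the value 200, nonzero in characteristic 0. The final zeros
     stand for the four y-values, which do not occur in [G]. *)
  have := GE [tuple 1; 2; 4; 3; 1; 2; 2; 1; 5; 0; 0; 0; 0] => /= G1.
  apply: contra_eq_neq G1 => ->; rewrite meval0 eq_sym.
  have -> : 5 * (4 * 3 * 1 * 2 - 1 * 2 * 2 * 1) * (1 - 2) * (4 - 3) * (4 - 5)
    * (3 - 5) * (1 - 2) * (2 - 1) = 200 :> complex R by ring.
  by rewrite Num.Theory.pnatr_eq0.
move=> a1 a2 a3 a4 b1 b2 b3 b4 z y yq yp yT nz Gnz q.
have /= /and5P[a10 a20 a30 a40 /and5P[b10 b20 b30 b40]] := nz.
move=> /and5P[y0 yq0 yp0 yT0 _].
move: Gnz; rewrite GE /= !mulf_eq0 !negb_or -!andbA.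
move=> /and5P[z0 q1 a12 a34 /and4P[a3z a4z b12 b34]].
have q0 : q != 0 by rewrite !mulf_neq0 ?invr_eq0 ?mulf_neq0.
have {}q1 : q - 1 != 0.
  (* Multiplying q - 1 by a1 a2 b3 b4 gives the second factor of [G]. *)
  rewrite -(inj_eq (mulIf (x := a1 * a2 * b3 * b4) _)) ?mulf_neq0 //.
  by rewrite mul0r mulrBl mul1r divfK ?mulf_neq0.
split.
  exists (bipoly 3 2 (lax1_coef a1 a2 a3 a4 b1 b2 b3 b4 q z y yq yp)).
  split; first by apply: cleared_lax1; rewrite /= a10 a20 b10 b20 b30 b40 q0.
  apply: (@unique_curve_through_coef _ _ _ _ _ 3 2).
  - exact: bideg_bipoly.
  - by apply: all_lax1_points; rewrite /= a10 a20 a30 a40 b10 b20 b30 b40 y0 yq0.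
  (* The coefficient of f^3 g^2 is y z / (b3 b4). *)
  - by rewrite coef_bipoly /lax1_coef /= opprK !mulf_neq0 ?invr_eq0 ?mulf_neq0.
  move=> P; apply: lax1_points_inj.
  by rewrite /= a10 a20 q0 y0 yq0 yp0 z0 q1 a12 a34 a3z a4z b12 b34.
exists (bipoly 1 1 (lax2_coef a1 a2 q z y yq yT)); split.
  exact: cleared_lax2.
by apply: unique_lax2; rewrite /= a10 a20 q0 z0 y0 yq0 yT0.
Qed.
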